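(* Let $\mathbf E=\{E_i\}_{i=1}^n$ be a POVM on a $d$-dimensional Hilbert space $\mathcal H$. The set of POVM-incoherent operations of $\mathbf E$ is independent of the Naimark extension of $\mathbf E$ chosen to define it, and it can be characterized by a semidefinite feasibility problem (SDP). In the case where $\mathbf E$ is a von Neumann measurement, i.e. $E_i=|i\rangle\langle i|$ for an orthonormal basis $\{|i\rangle\}$ of $\mathcal H$, the POVM-incoherent operations of $\mathbf E$ are equivalent to the maximally incoherent operations (MIO) of standard coherence theory.
   Context: All Hilbert spaces are finite-dimensional. A POVM on $\mathcal H$ is a set $\{E_i\}_{i=1}^n$ of positive semidefinite operators with $\sum_iE_i=\mathbb 1$; a projective measurement is a POVM $\{P_i\}$ with $P_iP_j=\delta_{ij}P_i$ (the projectors may have arbitrary ranks). A channel is a completely positive trace-preserving linear map. Naimark extension of $\mathbf E$: a projective measurement $\mathbf P=\{P_i\}_{i=1}^n$ on a Hilbert space $\mathcal H'$ of dimension $d'\ge d$ containing $\mathcal H$ as an orthogonal direct summand, such that $\operatorname{tr}[E_i\rho]=\operatorname{tr}[P_i(\rho\oplus 0)]$ for all $i$ and all states $\rho$ on $\mathcal H$, where $0$ is the zero matrix of dimension $d'-d$. Let $\mathcal E[\rho]=\rho\oplus 0$ be the embedding map, $\mathcal S'$ the set of states on $\mathcal H'$, $\mathcal S_{\mathcal E}\subseteq\mathcal S'$ the set of embedded states $\rho\oplus 0$, $\Delta[X]=\sum_iP_iXP_i$ the block-dephasing map, and $\mathcal I=\{\Delta[\sigma]:\sigma\in\mathcal S'\}$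 the set of block-incoherent states. POVM-incoherent operation of $\mathbf E$ (defined by means of a Naimark extension $\mathbf P$): a map $\Lambda_{\rm PIC}=\mathcal E^{-1}\circ\Lambda'\circ\mathcal E$ on the states of $\mathcal H$, where $\Lambda'$ is a channel on $\mathcal S'$ that is (i) block-incoherent with respect to $\mathbf P$: $\Lambda'[\mathcal I]\subseteq\mathcal I$ (equivalently $\Lambda'\circ\Delta=\Delta\circ\Lambda'\circ\Delta$), and (ii) subspace-preserving: $\Lambda'[\mathcal S_{\mathcal E}]\subseteq\mathcal S_{\mathcal E}$. Maximally incoherent operations (MIO) of standard coherence theory with respect to an orthonormal basis $\{|i\rangle\}$ of $\mathcal H$: the channels on the states of $\mathcal H$ that map every state diagonal in this basis to a state diagonal in this basis. A semidefinite feasibility problem is the problem of deciding whether there exists a matrix satisfying given linear constraints and positive-semidefiniteness constraints. *)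

(* Defs.v *)
From HB Require Import structures.
From mathcomp Require Import all_boot all_order all_algebra.
From mathcomp Require Import spectral.
From mathcomp Require Export complex.
From mathcomp Require Export classical_sets reals.

Set Implicit Arguments.
Unset Strict Implicit.
Unset Printing Implicit Defensive.

Import Order.TTheory GRing.Theory Num.Theory.
Local Open Scope ring_scope.
Local Open Scope classical_set_scope.
Local Open Scope sesquilinear_scope.

(* A d-dimensional Hilbert space is C^d, its operators are 'M[C]_d acting on  *)
(* column vectors.  In a numClosedFieldType, 0 <= z entails that z is real,   *)
(* so that psdmx A forces A to be Hermitian.                                  *)
Definition psdmx (C : numClosedFieldType) (n : nat) (A : 'M[C]_n) : Prop :=
  forall v : 'cV[C]_n, 0 <= (v^t* *m A *m v) 0 0.

Definition states (C : numClosedFieldType) (n : nat) : set 'M[C]_n :=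
  [set rho | psdmx rho /\ \tr rho = 1].

Definition povm (C : numClosedFieldType) (n d : nat)
    (E : 'I_n -> 'M[C]_d) : Prop :=
  (forall i, psdmx (E i)) /\ \sum_i E i = 1%:M.

Definition projective_measurement (C : numClosedFieldType) (n d : nat)
    (P : 'I_n -> 'M[C]_d) : Prop :=
  povm P /\ forall i j, P i *m P j = if i == j then P i else 0.

(* Maps on states are represented by their (unique) linear extension to all   *)
(* operators.                                                                 *)
Definition superop (C : numClosedFieldType) (d : nat) : Type :=
  {linear 'M[C]_d -> 'M[C]_d}.

(* id_k (x) L, acting on k x k block matrices with d x d blocks.              *)
Definition ampliation (C : numClosedFieldType) (d k : nat)
    (L : 'M[C]_d -> 'M[C]_d) (X : 'M[C]_(\sum_(i < k) d)) :
    'M[C]_(\sum_(i < k) d) :=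
  \mxblock_(i < k, j < k)
    L (submxblock (p_ := fun=> d) (q_ := fun=> d) X i j).

Definition completely_positive (C : numClosedFieldType) (d : nat)
    (L : 'M[C]_d -> 'M[C]_d) : Prop :=
  forall (k : nat) (X : 'M[C]_(\sum_(i < k) d)),
    psdmx X -> psdmx (ampliation L X).

Definition trace_preserving (C : numClosedFieldType) (d : nat)
    (L : 'M[C]_d -> 'M[C]_d) : Prop :=
  forall X, \tr (L X) = \tr X.

Definition channel (C : numClosedFieldType) (d : nat)
    (L : superop C d) : Prop :=
  completely_positive L /\ trace_preserving L.

(* The map rho |-> rho (+) 0 from C^d to C^d' with d' = d + m, and its        *)
(* inverse on the embedded operators.                                         *)
Definition embed (C : numClosedFieldType) (d m : nat) (X : 'M[C]_d) :
    'M[C]_(d + m) :=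
  block_mx X 0 0 0.

Definition unembed (C : numClosedFieldType) (d m : nat) (Y : 'M[C]_(d + m)) :
    'M[C]_d :=
  ulsubmx Y.

Definition embedded_states (C : numClosedFieldType) (d m : nat) :
    set 'M[C]_(d + m) :=
  @embed C d m @` @states C d.

Definition naimark_extension (C : numClosedFieldType) (n d m : nat)
    (E : 'I_n -> 'M[C]_d) (P : 'I_n -> 'M[C]_(d + m)) : Prop :=
  projective_measurement P /\
  forall (i : 'I_n) (rho : 'M[C]_d), states rho ->
    \tr (E i *m rho) = \tr (P i *m embed m rho).

Definition dephasing (C : numClosedFieldType) (n d : nat)
    (P : 'I_n -> 'M[C]_d) (X : 'M[C]_d) : 'M[C]_d :=
  \sum_i P i *m X *m P i.

Definition block_incoherent_states (C : numClosedFieldType) (n d : nat)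
    (P : 'I_n -> 'M[C]_d) : set 'M[C]_d :=
  dephasing P @` @states C d.

Definition block_incoherent (C : numClosedFieldType) (n d : nat)
    (P : 'I_n -> 'M[C]_d) (L : superop C d) : Prop :=
  L @` block_incoherent_states P `<=` block_incoherent_states P.

Definition subspace_preserving (C : numClosedFieldType) (d m : nat)
    (L : superop C (d + m)) : Prop :=
  L @` @embedded_states C d m `<=` @embedded_states C d m.

Definition pic_of_extension (C : numClosedFieldType) (n d m : nat)
    (P : 'I_n -> 'M[C]_(d + m)) : set (superop C d) :=
  [set L | exists L' : superop C (d + m),
     [/\ channel L', block_incoherent P L', subspace_preserving L' &
       forall rho, states rho -> L rho = unembed (L' (embed m rho))]].

Definition pic (C : numClosedFieldType) (n d : nat)
    (E : 'I_n -> 'M[C]_d) : set (superop C d) :=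
  [set L | exists (m : nat) (P : 'I_n -> 'M[C]_(d + m)),
     naimark_extension E P /\ pic_of_extension P L].

(* A complex equation amounts to two real ones, given by the Hermitian and    *)
(* anti-Hermitian parts of A k.                                               *)
Definition sdp_feasible (C : numClosedFieldType) (N K : nat)
    (A : 'I_K -> 'M[C]_N) (b : 'I_K -> C) : Prop :=
  exists X : 'M[C]_N, psdmx X /\ forall k, \tr (A k *m X) = b k.

(* The Choi matrix \sum_(i, j) |i><j| (x) L(|i><j|).                          *)
Definition choi (C : numClosedFieldType) (d : nat) (L : superop C d) :
    'M[C]_(\sum_(i < d) d) :=
  \mxblock_(i < d, j < d) (L (delta_mx i j) : 'M[C]_d).

(* Membership of L in S is decided by one semidefinite feasibility problem,   *)
(* into which L enters only as input data: the data A, B, c depend on S       *)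
(* alone, and the right-hand sides are affine in the Choi matrix of L.  (If   *)
(* the problem could depend on L arbitrarily, every S would qualify.)         *)
Definition sdp_characterizable (C : numClosedFieldType) (d : nat)
    (S : set (superop C d)) : Prop :=
  exists (N K : nat) (A : 'I_K -> 'M[C]_N)
         (B : 'I_K -> 'M[C]_(\sum_(i < d) d)) (c : 'I_K -> C),
    S = [set L | sdp_feasible A (fun k => \tr (B k *m choi L) + c k)].

Definition orthonormal_basis (C : numClosedFieldType) (n d : nat)
    (e : 'I_n -> 'cV[C]_d) : Prop :=
  (forall i j, (e i)^t* *m e j = ((i == j)%:R)%:M) /\
  (forall v : 'cV[C]_d, exists a : 'I_n -> C, v = \sum_i a i *: e i).

Definition diagonal_in (C : numClosedFieldType) (n d : nat)
    (e : 'I_n -> 'cV[C]_d) (X : 'M[C]_d) : Prop :=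
  forall i j, i != j -> (e i)^t* *m X *m e j = 0.

Definition mio (C : numClosedFieldType) (n d : nat)
    (e : 'I_n -> 'cV[C]_d) : set (superop C d) :=
  [set L | channel L /\
     forall rho, states rho -> diagonal_in e rho ->
       states (L rho) /\ diagonal_in e (L rho)].

(* Main.v *)
Require Import Defs.
From HB Require Import structures.
From mathcomp Require Import all_boot all_order all_algebra spectral boolp.

(* Write V for the inclusion of C^d into a Naimark space.  The vectors P_i V x
   satisfy (P_i V)^* (P_j V) = delta_ij E_i, a Gram matrix that depends on E
   only; hence any two Naimark extensions are related by a partial isometry T
   between the spans of these vectors, with T P_i = P'_i T and T V = V'.
   Explicitly, T is the sum of the P'_i V' G_i V^* P_i for a Hermitian reflexive
   generalized inverse G_i of E_i.  A channel L realizing a POVM-incoherent map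
   on the first space is transported to
     X |-> T L(T^* X T) T^* + (the trace lost by T) sigma
   on the second, where sigma is the maximally mixed state.

   For a fixed extension, complete positivity of L means that its Choi matrix is
   positive semidefinite, and all other conditions are linear in the Choi matrix.

   A von Neumann measurement is its own Naimark extension, and its block-dephasing
   map fixes exactly the diagonal operators. *)

Set Implicit Arguments.
Unset Strict Implicit.
Unset Printing Implicit Defensive.

Import Order.TTheory GRing.Theory Num.Theory.
Local Open Scope ring_scope.
Local Open Scope sesquilinear_scope.

(** * Adjoints, Gram matrices and positive semidefinite matrices *)

Lemma adjmxM (C : numClosedFieldType) (m n p : nat)
    (A : 'M[C]_(m, n)) (B : 'M[C]_(n, p)) :
  (A *m B)^t* = B^t* *m A^t*.
Proof. by rewrite trmx_mul map_mxM. Qed.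

Lemma adjmx_sum (C : numClosedFieldType) (m n : nat) (I : finType)
    (A : I -> 'M[C]_(m, n)) :
  (\sum_i A i)^t* = \sum_i (A i)^t*.
Proof. by rewrite !raddf_sum. Qed.

Lemma adjmx1 (C : numClosedFieldType) (n : nat) : (1%:M : 'M[C]_n)^t* = 1%:M.
Proof. by rewrite trmx1 map_mx1. Qed.

Lemma gram_diag (C : numClosedFieldType) (m n : nat) (A : 'M[C]_(m, n)) (j : 'I_n) :
  (A^t* *m A) j j = \sum_i `|A i j| ^+ 2.
Proof. by rewrite mxE; apply: eq_bigr => i _; rewrite !mxE normCK mulrC. Qed.

Lemma gram_eq0 (C : numClosedFieldType) (m n : nat) (A : 'M[C]_(m, n)) :
  A^t* *m A = 0 -> A = 0.
Proof.
move=> A0; apply/matrixP => i j; apply/eqP; rewrite mxE -normr_eq0 -sqrf_eq0.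
have /eqP := gram_diag A j; rewrite A0 mxE eq_sym psumr_eq0 => [/allP /(_ i)|k _].
  by rewrite mem_index_enum => /(_ isT).
by rewrite exprn_ge0.
Qed.

Lemma psd_gram (C : numClosedFieldType) (m n : nat) (A : 'M[C]_(m, n)) :
  psdmx (A *m A^t*).
Proof.
move=> v; rewrite !mulmxA -mulmxA -{1}[A]trmxCK -adjmxM gram_diag.
by apply: sumr_ge0 => i _; rewrite exprn_ge0.
Qed.

Lemma psd_conj (C : numClosedFieldType) (m n : nat) (A : 'M[C]_n)
    (K : 'M[C]_(m, n)) :
  psdmx A -> psdmx (K *m A *m K^t*).
Proof.
by move=> Apsd v; have := Apsd (K^t* *m v); rewrite adjmxM trmxCK !mulmxA.
Qed.

Lemma psd_sum (C : numClosedFieldType) (n : nat) (I : finType)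
    (A : I -> 'M[C]_n) :
  (forall i, psdmx (A i)) -> psdmx (\sum_i A i).
Proof.
move=> Apsd v; rewrite mulmx_sumr mulmx_suml summxE.
by apply: sumr_ge0 => i _; apply: Apsd.
Qed.

Lemma linear_rank1_eq0 (C : numClosedFieldType) (n : nat) (V : lmodType C)
    (f : {linear 'M[C]_n -> V}) :
  (forall v : 'cV[C]_n, f (v *m v^t*) = 0) -> forall X, f X = 0.
Proof.
move=> f1; suff uv (u v : 'cV[C]_n) : f (u *m v^t*) = 0.
  move=> X; rewrite (matrix_sum_delta X) linear_sum big1 // => i _.
  rewrite linear_sum big1 // => j _; rewrite linearZ /=.
  have -> : delta_mx i j = (delta_mx i 0 : 'cV[C]_n) *m (delta_mx j 0)^t*.
    by rewrite trmx_delta map_delta_mx mul_delta_mx.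
  by rewrite uv scaler0.
have sym (x y : 'cV[C]_n) : f (x *m y^t*) + f (y *m x^t*) = 0.
  have := f1 (x + y); rewrite linearD map_mxD mulmxDl !mulmxDr !linearD /= !f1.
  by rewrite add0r addr0.
have := sym u ('i *: v); rewrite linearZ map_mxZ -scalemxAr -scalemxAl !linearZ /=.
rewrite conjCi scaleNr addrC => /subr0_eq /(scalerI (neq0Ci _)) vu.
have /eqP := sym u v; rewrite vu -mulr2n -scaler_nat scaler_eq0 pnatr_eq0 /=.
by move=> /eqP.
Qed.

(** Bundles a bare function with its linearity proof, so that maps given by formulas can be used as
    a [superop] or under the generic linearity lemmas. *)
Lemma linear_pack (K : nzRingType) (U V : lmodType K) (f : U -> V) :
  linear f -> exists g : {linear U -> V}, g =1 f.
Proof.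
move=> flin; pose F := GRing.isLinear.Build K _ _ _ f flin.
pose g : {linear U -> V} := HB.pack f F.
by exists g.
Qed.

(** States span all operators: a nonzero [v *m v^t*] is a positive multiple of a state, so [f - g]
    vanishes on every rank-one matrix of this form. *)
Lemma linear_states_eq (C : numClosedFieldType) (n : nat) (V : lmodType C)
    (f g : 'M[C]_n -> V) :
  linear f -> linear g -> (forall rho, states rho -> f rho = g rho) -> f =1 g.
Proof.
move=> flin glin fg X; apply: subr0_eq.
have [h hE] : exists h : {linear 'M[C]_n -> V}, h =1 (fun X => f X - g X).
  by apply: linear_pack => a u v; rewrite flin glin scalerBr opprD addrACA.
rewrite -hE; apply: linear_rank1_eq0 => {X} v.
have [->|v0] := eqVneq v 0; first by rewrite mul0mx linear0.
set t := \tr (v *m v^t*).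
have tE : t = (v^t* *m v) 0 0 by rewrite /t mxtrace_mulC /mxtrace big_ord1.
have t0 : t != 0.
  apply: contra v0 => /eqP t0; apply/eqP/gram_eq0/matrixP => i j.
  by rewrite !ord1 -tE t0 mxE.
have tge : 0 <= t by rewrite tE gram_diag sumr_ge0 // => i _; rewrite exprn_ge0.
have st : states (t^-1 *: (v *m v^t*)).
  split; last by rewrite linearZ /= mulVf.
  move=> w; rewrite -scalemxAr -scalemxAl mxE mulr_ge0 ?invr_ge0 //.
  exact: psd_gram.
by rewrite -[v *m _]scale1r -(mulfV t0) -scalerA linearZ /= hE (fg _ st) subrr scaler0.
Qed.

(** Since [v^t* *m A *m v] is real, the functional given by the trace against [A^t* - A] vanishes on
    each [v *m v^t*], hence everywhere by polarization. *)
Lemma psd_adj (C : numClosedFieldType) (n : nat) (A : 'M[C]_n) :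
  psdmx A -> A^t* = A.
Proof.
move=> Apsd; have [f fE] : exists f : {linear 'M[C]_n -> C^o},
    f =1 (fun X => \tr ((A^t* - A) *m X)).
  by apply: linear_pack => a u v; rewrite mulmxDr -scalemxAr linearD linearZ.
suff f0 X : f X = 0.
  apply: subr0_eq; apply/matrixP => i j; rewrite [RHS]mxE.
  have := f0 (delta_mx j i); rewrite fE mxtrace_mulC.
  rewrite /mxtrace (bigD1 j) //= big1 => [|k kj].
    rewrite addr0 mxE (bigD1 i) //= big1 => [|l li].
      by rewrite addr0 !mxE !eqxx mul1r.
    by rewrite !mxE (negPf li) andbF mul0r.
  by rewrite mxE big1 // => l _; rewrite !mxE (negPf kj) mul0r.
apply: linear_rank1_eq0 => v; rewrite fE mulmxA mxtrace_mulC mulmxA mulmxBr mulmxBl.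
have vAv : v^t* *m A^t* *m v = (v^t* *m A *m v)^t*.
  by rewrite !adjmxM trmxCK mulmxA.
rewrite linearB /= vAv /mxtrace !big_ord1; have := Apsd v.
by move: (v^t* *m A *m v) => z z0; rewrite !mxE geC0_conj ?subrr.
Qed.

(** [A] is Hermitian, hence unitarily diagonalizable, and its eigenvalues are nonnegative; [W]
    carries their square roots. *)
Lemma psd_sqrt (C : numClosedFieldType) (n : nat) (A : 'M[C]_n) :
  psdmx A -> exists W : 'M[C]_n, A = W *m W^t*.
Proof.
move=> Apsd; have Aherm := psd_adj Apsd.
have /orthomx_spectralP : A \is normalmx by apply/normalmxP; rewrite Aherm.
set P := spectralmx A; set s := spectral_diag A => AE.
have Pu : P \is unitarymx := spectral_unitarymx A.
rewrite invmx_unitary // in AE.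
have PAP : P *m A *m P^t* = diag_mx s.
  by rewrite {1}AE !mulmxA (unitarymxP Pu) mul1mx -mulmxA (unitarymxP Pu) mulmx1.
have s_ge0 i : 0 <= s 0 i.
  have := psd_conj P Apsd (delta_mx i 0); rewrite PAP.
  by rewrite trmx_delta map_delta_mx -rowE -colE !mxE eqxx mulr1n.
exists (P^t* *m diag_mx (map_mx sqrtC s)).
rewrite adjmxM trmxCK mulmxA -(mulmxA (P^t*)) tr_diag_mx map_diag_mx mulmx_diag.
rewrite {1}AE; congr (_ *m diag_mx _ *m _); apply/rowP => i; rewrite !mxE.
by rewrite /= geC0_conj ?sqrtC_ge0 // -expr2 sqrtCK.
Qed.

(** * Block matrices and completely positive maps *)

Lemma adjmx_mxcol (C : numClosedFieldType) (k n : nat) (p : 'I_k -> nat)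
    (A : forall i, 'M[C]_(p i, n)) :
  (\mxcol_i A i)^t* = \mxrow_i (A i)^t*.
Proof. by apply/matrixP => i j; rewrite !mxE. Qed.

Lemma adjmx_mxblock (C : numClosedFieldType) (k l : nat) (p : 'I_k -> nat)
    (q : 'I_l -> nat) (A : forall i j, 'M[C]_(p i, q j)) :
  (\mxblock_(i, j) A i j)^t* = \mxblock_(i, j) (A j i)^t*.
Proof. by apply/matrixP => i j; rewrite !mxE. Qed.

Lemma eq_completely_positive (C : numClosedFieldType) (d : nat)
    (L L' : 'M[C]_d -> 'M[C]_d) :
  L =1 L' -> completely_positive L -> completely_positive L'.
Proof.
move=> LL' Lcp k X Xpsd; suff <- : ampliation L X = ampliation L' X by exact: Lcp.
by apply: eq_mxblock => i j; rewrite LL'.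
Qed.

Lemma completely_positive_id (C : numClosedFieldType) (d : nat) :
  completely_positive (fun X : 'M[C]_d => X).
Proof. by move=> k X; rewrite /ampliation submxblockK. Qed.

(** This is the ampliation with a single block. Conjugation by a one-block column of identities
    passes between the dimensions [d] and [\sum_(i < 1) d]. *)
Lemma completely_positive_psd (C : numClosedFieldType) (d : nat)
    (L : superop C d) (X : 'M[C]_d) :
  completely_positive L -> psdmx X -> psdmx (L X).
Proof.
move=> Lcp Xpsd; have /(Lcp 1%N) LXpsd : psdmx (\mxblock_(i < 1, j < 1) X).
  suff -> : \mxblock_(i < 1, j < 1) X =
      (\mxcol_(i < 1) 1%:M) *m X *m (\mxcol_(i < 1) 1%:M)^t*.
    exact: psd_conj.
  rewrite adjmx_mxcol mxcol_mul mul_mxcol_mxrow.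
  by apply: eq_mxblock => i j; rewrite adjmx1 mulmx1 mul1mx.
have := psd_conj ((\mxcol_(i < 1) 1%:M)^t*) LXpsd.
rewrite /ampliation trmxCK adjmx_mxcol mul_mxrow_mxblock mul_mxrow_mxcol.
by rewrite !big_ord1 adjmx1 mulmx1 mul1mx mxblockK.
Qed.

Lemma completely_positive_sum (C : numClosedFieldType) (d : nat) (I : finType)
    (L : I -> 'M[C]_d -> 'M[C]_d) :
  (forall i, completely_positive (L i)) ->
  completely_positive (fun X => \sum_i L i X).
Proof.
move=> Lcp k X Xpsd; suff -> : ampliation (fun Y => \sum_i L i Y) X =
    \sum_i ampliation (L i) X by apply: psd_sum => i; apply: Lcp.
by rewrite /ampliation mxblock_sum.
Qed.

Lemma completely_positiveD (C : numClosedFieldType) (d : nat)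
    (L L' : 'M[C]_d -> 'M[C]_d) :
  completely_positive L -> completely_positive L' ->
  completely_positive (fun X => L X + L' X).
Proof.
move=> Lcp Lcp'.
apply: (@eq_completely_positive _ _ (fun X => \sum_(b : bool) (if b then L else L') X)).
  by move=> X; rewrite big_bool.
by apply: completely_positive_sum => -[].
Qed.

Lemma completely_positive_conj (C : numClosedFieldType) (d d' : nat)
    (L : 'M[C]_d -> 'M[C]_d) (S : 'M[C]_(d, d')) (K : 'M[C]_(d', d)) :
  completely_positive L ->
  completely_positive (fun X => K *m L (S *m X *m S^t*) *m K^t*).
Proof.
move=> Lcp k X Xpsd.
(* [dg A] is the tensor product of the identity of size [k] with [A]; conjugating by it conjugates
   every block by [A]. *)
pose dg (p q : nat) (A : 'M[C]_(p, q)) : 'M[C]_(\sum_(i < k) p, \sum_(i < k) q) :=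
  \mxblock_(i, j) (if i == j then A else 0).
have dgM p q (A : 'M[C]_(p, q)) (Y : 'M[C]_(\sum_(i < k) q)) :
    dg _ _ A *m Y *m (dg _ _ A)^t* =
    \mxblock_(i < k, j < k) (A *m submxblock Y i j *m A^t*).
  rewrite /dg adjmx_mxblock -{1}[Y]submxblockK !mul_mxblock.
  apply: eq_mxblock => i j; rewrite (bigD1 j) //= [X in _ + X]big1 => [|l lj].
    rewrite eqxx addr0 (bigD1 i) //= [X in _ + X]big1 => [|l li].
      by rewrite eqxx addr0.
    by rewrite eq_sym (negPf li) mul0mx.
  by rewrite eq_sym (negPf lj) trmx0 map_mx0 mulmx0.
suff -> : ampliation (fun Y => K *m L (S *m Y *m S^t*) *m K^t*) X =
  dg _ _ K *m ampliation L (dg _ _ S *m X *m (dg _ _ S)^t*) *m (dg _ _ K)^t*.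
  by apply/psd_conj/Lcp/psd_conj.
rewrite !dgM {1}/ampliation; apply: eq_mxblock => i j.
by rewrite /ampliation !mxblockK.
Qed.

(** A measure-and-prepare map. Its Kraus operators, applied after [L], are the products of a column
    of a square root of [sigma] with the adjoint of a column of a square root of [M]. *)
Lemma completely_positive_replace (C : numClosedFieldType) (d d' : nat)
    (L : 'M[C]_d -> 'M[C]_d) (S : 'M[C]_(d, d')) (M : 'M[C]_d) (sigma : 'M[C]_d') :
  completely_positive L -> psdmx M -> psdmx sigma ->
  completely_positive (fun X => \tr (M *m L (S *m X *m S^t*)) *: sigma).
Proof.
move=> Lcp /psd_sqrt[W ->] /psd_sqrt[Z ->].
pose K (kl : 'I_d * 'I_d') := col kl.2 Z *m (col kl.1 W)^t*.
apply: (@eq_completely_positive _ _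
  (fun X => \sum_kl (K kl *m L (S *m X *m S^t*) *m (K kl)^t*))); last first.
  by apply: completely_positive_sum => kl; apply: completely_positive_conj.
move=> X; move: (L _) => Y; rewrite /K.
rewrite -(pair_bigA _ (fun k l => (col l Z *m (col k W)^t*) *m Y *m
  (col l Z *m (col k W)^t*)^t*)) /=.
have colsE p q (A : 'M[C]_(p, q)) : A *m A^t* = \sum_l col l A *m (col l A)^t*.
  apply/matrixP => i j; rewrite mxE summxE; apply: eq_bigr => l _.
  by rewrite [RHS]mxE big_ord1 !mxE.
rewrite (colsE _ _ W) mulmx_suml linear_sum /= scaler_suml; apply: eq_bigr => k _.
rewrite (colsE _ _ Z) scaler_sumr; apply: eq_bigr => l _.
rewrite adjmxM trmxCK -!mulmxA mxtrace_mulC; set c := \tr _.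
have -> : (col k W)^t* *m (Y *m (col k W *m (col l Z)^t*)) = c *: (col l Z)^t*.
  rewrite !mulmxA -mul_scalar_mx; congr (_ *m _).
  by rewrite /c [LHS]mx11_scalar /mxtrace big_ord1.
by rewrite scalemxAr.
Qed.

(** * The Choi correspondence *)

(** The inverse of the Choi correspondence, defined on every matrix so that the unknown of a
    semidefinite problem can be read as a map. *)
Definition of_choi (C : numClosedFieldType) (d : nat)
    (J : 'M[C]_(\sum_(i < d) d)) (X : 'M[C]_d) : 'M[C]_d :=
  \sum_i \sum_j X i j *: submxblock (p_ := fun=> d) (q_ := fun=> d) J i j.

Lemma of_choiK (C : numClosedFieldType) (d : nat) (L : superop C d) :
  of_choi (choi L) =1 L.
Proof.
move=> X; rewrite [in RHS](matrix_sum_delta X) linear_sum; apply: eq_bigr => i _.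
by rewrite linear_sum; apply: eq_bigr => j _; rewrite linearZ /= /choi mxblockK.
Qed.

Lemma of_choi_linear (C : numClosedFieldType) (d : nat)
    (J : 'M[C]_(\sum_(i < d) d)) : linear (of_choi J).
Proof.
move=> a X Y; rewrite /of_choi scaler_sumr -big_split; apply: eq_bigr => i _ /=.
rewrite scaler_sumr -big_split; apply: eq_bigr => j _ /=.
by rewrite !mxE scalerDl scalerA.
Qed.

Lemma of_choi_linearl (C : numClosedFieldType) (d : nat) (X : 'M[C]_d) :
  linear (fun J : 'M[C]_(\sum_(i < d) d) => of_choi J X).
Proof.
move=> a J J'; rewrite /of_choi scaler_sumr -big_split; apply: eq_bigr => i _ /=.
rewrite scaler_sumr -big_split; apply: eq_bigr => j _ /=.
by apply/matrixP => k l; rewrite !mxE mulrDr !mulrA (mulrC a).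
Qed.

Lemma of_choi_completely_positive (C : numClosedFieldType) (d : nat)
    (J : 'M[C]_(\sum_(i < d) d)) :
  psdmx J -> completely_positive (of_choi J).
Proof.
move=> /psd_sqrt[W JE].
(* The columns of a square root of J, reshaped into matrices, are Kraus
   operators. *)
pose K l : 'M[C]_d := \matrix_(a, i) (submxcol (p_ := fun=> d) W i) a l.
apply: (@eq_completely_positive _ _ (fun X => \sum_l K l *m X *m (K l)^t*)).
  move=> X; apply/matrixP => a b; rewrite /of_choi !summxE.
  transitivity (\sum_l \sum_i \sum_j X i j * (K l a i * (K l b j)^*)).
    apply: eq_bigr => l _; rewrite mxE exchange_big; apply: eq_bigr => j _.
    rewrite mxE mulr_suml; apply: eq_bigr => i _.
    by rewrite !mxE mulrA (mulrC (X i j)).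
  rewrite exchange_big; apply: eq_bigr => i _; rewrite summxE exchange_big.
  apply: eq_bigr => j _; rewrite -mulr_sumr !mxE; congr (_ * _).
  by rewrite JE mxE; apply: eq_bigr => l _; rewrite !mxE.
apply: completely_positive_sum => l.
apply: (@eq_completely_positive _ _
  (fun X => K l *m (1%:M *m X *m 1%:M^t*) *m (K l)^t*)).
  by move=> X; rewrite adjmx1 mulmx1 mul1mx.
apply: (completely_positive_conj (L := fun X => X)).
exact: completely_positive_id.
Qed.

(** The Choi matrix is the ampliation of [L] at the unnormalized maximally entangled state, which
    has the form [v *m v^t*]. *)
Lemma choi_psd (C : numClosedFieldType) (d : nat) (L : superop C d) :
  completely_positive L -> psdmx (choi L).
Proof.
move=> Lcp; suff -> : choi L = ampliation L (\mxblock_(i, j) delta_mx i j).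
  apply: Lcp; pose v : 'cV[C]_(\sum_(i < d) d) := \mxcol_i delta_mx i 0.
  suff -> : \mxblock_(i, j) delta_mx i j = v *m v^t* by exact: psd_gram.
  rewrite /v adjmx_mxcol mul_mxcol_mxrow; apply: eq_mxblock => i j.
  by rewrite trmx_delta map_delta_mx mul_delta_mx.
by apply: eq_mxblock => i j; rewrite mxblockK.
Qed.

Lemma channel_states (C : numClosedFieldType) (d : nat) (L : superop C d)
    (rho : 'M[C]_d) :
  channel L -> states rho -> states (L rho).
Proof.
by move=> [Lcp Ltp] [rho0 rho1]; split; [exact: completely_positive_psd|rewrite Ltp].
Qed.

(** * The embedding, block-dephasing, and linear forms of the defining conditions *)

(** The isometry V of the overview, through which [embed] and [unembed] become matrix products. *)
Definition inclusion (C : numClosedFieldType) (d m : nat) : 'M[C]_(d + m, d) :=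
  col_mx 1%:M 0.
Arguments inclusion {C d} m.

Lemma adjmx_inclusion (C : numClosedFieldType) (d m : nat) :
  (@inclusion C d m)^t* = row_mx 1%:M 0.
Proof. by rewrite /inclusion tr_col_mx map_row_mx adjmx1 trmx0 map_mx0. Qed.

Lemma inclusion_isometry (C : numClosedFieldType) (d m : nat) :
  (@inclusion C d m)^t* *m inclusion m = 1%:M.
Proof. by rewrite adjmx_inclusion mul_row_col mulmx1 mulmx0 addr0. Qed.

Lemma embedE (C : numClosedFieldType) (d m : nat) (X : 'M[C]_d) :
  embed m X = inclusion m *m X *m (inclusion m)^t*.
Proof.
rewrite adjmx_inclusion mul_col_mx mul1mx mul0mx mul_col_row.
by rewrite !mulmx0 mulmx1 mul0mx.
Qed.

Lemma unembedE (C : numClosedFieldType) (d m : nat) (Y : 'M[C]_(d + m)) :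
  unembed Y = (inclusion m)^t* *m Y *m inclusion m.
Proof.
rewrite adjmx_inclusion -{2}[Y]submxK /unembed mul_row_block mul_row_col.
by rewrite !mul1mx !mul0mx !addr0 mulmx1 mulmx0 addr0.
Qed.

Lemma embedK (C : numClosedFieldType) (d m : nat) (X : 'M[C]_d) :
  unembed (embed m X) = X.
Proof. exact: block_mxKul. Qed.

Lemma embed_linear (C : numClosedFieldType) (d m : nat) : linear (@embed C d m).
Proof.
by move=> a X Y; rewrite !embedE mulmxDr mulmxDl -scalemxAr -scalemxAl.
Qed.

Lemma mxtrace_embed (C : numClosedFieldType) (d m : nat) (X : 'M[C]_d) :
  \tr (embed m X) = \tr X.
Proof. by rewrite mxtrace_block mxtrace0 addr0. Qed.

Lemma embed_states (C : numClosedFieldType) (d m : nat) (rho : 'M[C]_d) :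
  states (embed m rho) <-> states rho.
Proof.
split=> -[rho0 rho1]; split; rewrite ?mxtrace_embed // in rho1 *.
  by rewrite -(embedK m rho) unembedE -{2}[inclusion m]trmxCK; apply: psd_conj.
by rewrite embedE; apply: psd_conj.
Qed.

Lemma projective_measurement_adj (C : numClosedFieldType) (n d : nat)
    (P : 'I_n -> 'M[C]_d) (i : 'I_n) :
  projective_measurement P -> (P i)^t* = P i.
Proof. by move=> [[Ppsd _] _]; apply: psd_adj. Qed.

(** The equality of outcome probabilities on states extends linearly to all operators, and matrix
    units then read off the entries. *)
Lemma naimark_extension_compress (C : numClosedFieldType) (n d m : nat)
    (E : 'I_n -> 'M[C]_d) (P : 'I_n -> 'M[C]_(d + m)) (i : 'I_n) :
  naimark_extension E P -> (inclusion m)^t* *m P i *m inclusion m = E i.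
Proof.
move=> [_ EP]; set V := inclusion m.
have trE := @linear_states_eq C d C^o (fun X => \tr (E i *m X))
  (fun X => \tr (V^t* *m P i *m V *m X)).
have {}trE : forall X, \tr (E i *m X) = \tr (V^t* *m P i *m V *m X).
  apply: trE => [a X Y|a X Y|rho st]; try by rewrite mulmxDr -scalemxAr linearD linearZ.
  by rewrite EP // embedE mulmxA mxtrace_mulC !mulmxA.
have trd (A : 'M[C]_d) (k l : 'I_d) : A k l = \tr (A *m delta_mx l k).
  by rewrite -(mul_delta_mx (0 : 'I_1)) mulmxA mxtrace_mulC -rowE -colE /mxtrace big_ord1 !mxE.
by apply/matrixP => k l; rewrite trd -trE -trd.
Qed.

Lemma dephasing_linear (C : numClosedFieldType) (n d : nat)
    (P : 'I_n -> 'M[C]_d) : linear (dephasing P).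
Proof.
move=> a X Y; rewrite /dephasing scaler_sumr -big_split; apply: eq_bigr => i _.
by rewrite mulmxDr mulmxDl -scalemxAr -scalemxAl.
Qed.

Lemma dephasing_idem (C : numClosedFieldType) (n d : nat)
    (P : 'I_n -> 'M[C]_d) (X : 'M[C]_d) :
  projective_measurement P -> dephasing P (dephasing P X) = dephasing P X.
Proof.
move=> [_ PP]; rewrite {1}/dephasing; apply: eq_bigr => i _.
rewrite /dephasing mulmx_sumr mulmx_suml (bigD1 i) //= big1 => [|j ji].
  by rewrite addr0 !mulmxA PP eqxx -mulmxA PP eqxx.
by rewrite !mulmxA PP eq_sym (negPf ji) !mul0mx.
Qed.

Lemma dephasing_states (C : numClosedFieldType) (n d : nat)
    (P : 'I_n -> 'M[C]_d) (rho : 'M[C]_d) :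
  projective_measurement P -> states rho -> states (dephasing P rho).
Proof.
move=> Pm [rho0 rho1]; have [[_ P1] PP] := Pm; split.
  apply: psd_sum => i; rewrite -{2}(projective_measurement_adj i Pm).
  exact: psd_conj.
rewrite linear_sum /= -rho1 -[rho in RHS]mul1mx -P1 mulmx_suml linear_sum /=.
by apply: eq_bigr => i _; rewrite mxtrace_mulC mulmxA PP eqxx.
Qed.

(** By idempotence, block-incoherent states are fixed by [dephasing P]; as states span the
    operators, the inclusion of sets becomes a linear equation. *)
Lemma block_incoherentP (C : numClosedFieldType) (n d : nat)
    (P : 'I_n -> 'M[C]_d) (L : superop C d) :
  projective_measurement P -> channel L ->
  block_incoherent P L <->
  forall X, dephasing P (L (dephasing P X)) = L (dephasing P X).
Proof.
move=> Pm Lch; split=> [Linc|Linc _ [_ [rho st <-] <-]].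
  apply: linear_states_eq => [a X Y|a X Y|rho st].
  - by rewrite dephasing_linear linearP dephasing_linear.
  - by rewrite dephasing_linear linearP.
  have [|tau _ <-] := Linc (L (dephasing P rho)); last exact: dephasing_idem.
  by exists (dephasing P rho) => //; exists rho.
exists (L (dephasing P rho)); last exact: Linc.
by apply/channel_states/dephasing_states.
Qed.

(** Subspace preservation and the realization of [L] merge into one linear equation on all
    operators. Conversely, that equation makes [L rho] a state because [L'] is a channel. *)
Lemma pic_of_extensionP (C : numClosedFieldType) (n d m : nat)
    (P : 'I_n -> 'M[C]_(d + m)) (L : superop C d) :
  projective_measurement P ->
  pic_of_extension P L <-> exists L' : superop C (d + m),
    [/\ channel L',
        forall X, dephasing P (L' (dephasing P X)) = L' (dephasing P X) &
        forall X, L' (embed m X) = embed m (L X)].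
Proof.
move=> Pm; split=> -[L' [L'ch L'inc L'sub]].
  move=> L'L; exists L'; split => //; first exact/block_incoherentP.
  apply: linear_states_eq => [a X Y|a X Y|rho st].
  - by rewrite embed_linear linearP.
  - by rewrite linearP embed_linear.
  have [|tau _ tauE] := L'sub (L' (embed m rho)).
    by exists (embed m rho) => //; exists rho.
  by rewrite L'L // -tauE embedK.
exists L'; split => //; first exact/block_incoherentP.
- move=> _ [_ [rho st <-] <-]; rewrite L'sub; exists (L rho) => //.
  by apply/(embed_states m); rewrite -L'sub; apply/channel_states/embed_states.
- by move=> rho _; rewrite L'sub embedK.
Qed.

(** * The partial isometry between two Naimark extensions *)

(** For any generalized inverse [F] of the Hermitian matrix [A], its adjoint is another one, and
    [F *m A *m F^t*] is both Hermitian and reflexive. *)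
Lemma hermitian_ginv (C : numClosedFieldType) (d : nat) (A : 'M[C]_d) :
  psdmx A -> exists G : 'M[C]_d,
    [/\ G^t* = G, A *m G *m A = A & G *m A *m G = G].
Proof.
move=> /psd_adj Aadj; have : A *m pinvmx A *m A = A by apply: mulmxKpV.
move: (pinvmx A) => F AFA.
have AFA' : A *m F^t* *m A = A.
  by move/(congr1 (fun B => B^t*)): AFA; rewrite !adjmxM Aadj mulmxA.
exists (F *m A *m F^t*); split; first by rewrite !adjmxM trmxCK Aadj mulmxA.
  by rewrite !mulmxA AFA AFA'.
rewrite -!mulmxA; congr (_ *m _); rewrite !mulmxA.
by rewrite AFA' AFA.
Qed.

(** The difference of the two sides is [A *m (G *m E - 1%:M)], whose Gram matrix contains the factor
    [E *m G *m E - E] and so vanishes. *)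
Lemma gram_ginv (C : numClosedFieldType) (d p : nat) (A : 'M[C]_(p, d))
    (E G : 'M[C]_d) :
  A^t* *m A = E -> E *m G *m E = E -> A *m G *m E = A.
Proof.
move=> AE EGE; apply: subr0_eq; apply: gram_eq0.
rewrite [X in X^t*](_ : _ = A *m (G *m E - 1%:M)).
  by rewrite adjmxM -mulmxA mulmxBr !mulmxA AE EGE subrr mulmx0.
by rewrite mulmxBr mulmx1 mulmxA.
Qed.

(** If both families have the Gram matrix of the overview and each [G i] is a generalized inverse of
    [E i], this operator sends [A i *m x] to [B i *m x]. Arbitrary families are allowed so that
    bridges can be reversed and composed. *)
Definition bridge (C : numClosedFieldType) (n d p q : nat)
    (A : 'I_n -> 'M[C]_(p, d)) (B : 'I_n -> 'M[C]_(q, d))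
    (G : 'I_n -> 'M[C]_d) : 'M[C]_(q, p) :=
  \sum_i B i *m G i *m (A i)^t*.

Lemma adjmx_bridge (C : numClosedFieldType) (n d p q : nat)
    (A : 'I_n -> 'M[C]_(p, d)) (B : 'I_n -> 'M[C]_(q, d))
    (G : 'I_n -> 'M[C]_d) :
  (forall i, (G i)^t* = G i) -> (bridge A B G)^t* = bridge B A G.
Proof.
move=> Gadj; rewrite /bridge adjmx_sum; apply: eq_bigr => i _.
by rewrite !adjmxM trmxCK Gadj mulmxA.
Qed.

Lemma mul_bridge (C : numClosedFieldType) (n d p q r : nat)
    (A : 'I_n -> 'M[C]_(p, d)) (B : 'I_n -> 'M[C]_(q, d))
    (D : 'I_n -> 'M[C]_(r, d)) (E G : 'I_n -> 'M[C]_d) :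
  (forall i j, (B i)^t* *m B j = if i == j then E i else 0) ->
  (forall i, G i *m E i *m G i = G i) ->
  bridge B D G *m bridge A B G = bridge A D G.
Proof.
move=> BB GEG; rewrite /bridge mulmx_suml; apply: eq_bigr => i _.
rewrite mulmx_sumr (bigD1 i) //= big1 => [|j ji].
  rewrite addr0 !mulmxA -(mulmxA (D i *m G i)) BB eqxx.
  by rewrite -!(mulmxA (D i)) GEG.
by rewrite !mulmxA -(mulmxA (D i *m G i)) BB eq_sym (negPf ji) mulmx0 !mul0mx.
Qed.

Definition naimark_vectors (C : numClosedFieldType) (n d m : nat)
    (P : 'I_n -> 'M[C]_(d + m)) (i : 'I_n) : 'M[C]_(d + m, d) :=
  P i *m inclusion m.

Lemma gram_naimark_vectors (C : numClosedFieldType) (n d m : nat)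
    (E : 'I_n -> 'M[C]_d) (P : 'I_n -> 'M[C]_(d + m)) (i j : 'I_n) :
  naimark_extension E P ->
  (naimark_vectors P i)^t* *m naimark_vectors P j = if i == j then E i else 0.
Proof.
move=> EP; have [Pm _] := EP; rewrite adjmxM projective_measurement_adj //.
rewrite !mulmxA -(mulmxA _ (P i)) Pm.2; have [->|_] := eqVneq i j.
  exact: naimark_extension_compress.
by rewrite mulmx0 mul0mx.
Qed.

(** [T] is the bridge between the two families of Naimark vectors. Its adjoint is the reverse
    bridge, so composing three bridges gives the partial isometry law. *)
Lemma naimark_partial_isometry (C : numClosedFieldType) (n d m1 m2 : nat)
    (E : 'I_n -> 'M[C]_d) (P1 : 'I_n -> 'M[C]_(d + m1))
    (P2 : 'I_n -> 'M[C]_(d + m2)) :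
  povm E -> naimark_extension E P1 -> naimark_extension E P2 ->
  exists T : 'M[C]_(d + m2, d + m1),
    [/\ forall i, T *m P1 i = P2 i *m T,
        T *m inclusion m1 = inclusion m2, T^t* *m inclusion m2 = inclusion m1 &
        T *m T^t* *m T = T].
Proof.
move=> [Epsd _] EP1 EP2.
have /fin_all_exists[G GE] : forall i, exists G : 'M[C]_d,
    [/\ G^t* = G, E i *m G *m E i = E i & G *m E i *m G = G].
  by move=> i; apply: hermitian_ginv.
have Gadj i : (G i)^t* = G i by have [] := GE i.
have GEG i : G i *m E i *m G i = G i by have [] := GE i.
have bridge_inclusion m m' (P : 'I_n -> 'M[C]_(d + m)) (P' : 'I_n -> 'M[C]_(d + m')) :
    naimark_extension E P -> naimark_extension E P' ->
    bridge (naimark_vectors P) (naimark_vectors P') G *m inclusion m = inclusion m'.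
  (* Completeness of [P'] splits [inclusion m'] into the vectors [P' i *m inclusion m'], which are
     matched term by term. *)
  move=> EP EP'; rewrite -[RHS]mul1mx -EP'.1.1.2 /bridge !mulmx_suml.
  apply: eq_bigr => i _; have [_ EGE _] := GE i.
  have <- : naimark_vectors P' i *m G i *m E i = P' i *m inclusion m'.
    by apply: gram_ginv => //; rewrite (gram_naimark_vectors _ _ EP') eqxx.
  rewrite -(naimark_extension_compress i EP) /naimark_vectors adjmxM.
  by rewrite (projective_measurement_adj _ EP.1) !mulmxA.
exists (bridge (naimark_vectors P1) (naimark_vectors P2) G); split.
- move=> i; rewrite /bridge mulmx_suml mulmx_sumr; apply: eq_bigr => j _.
  rewrite /naimark_vectors adjmxM (projective_measurement_adj _ EP1.1) !mulmxA.
  rewrite EP2.1.2 -(mulmxA _ (P1 j)) EP1.1.2 eq_sym.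
  by have [->|_] := eqVneq i j; rewrite ?mulmx0 ?mul0mx ?mulmxA.
- exact: bridge_inclusion.
- by rewrite adjmx_bridge //; apply: bridge_inclusion.
- rewrite adjmx_bridge // (@mul_bridge C n d _ _ _ _ _ _ E) //.
    by rewrite (@mul_bridge C n d _ _ _ _ _ _ E) // => i j; apply: gram_naimark_vectors.
  by move=> i j; apply: gram_naimark_vectors.
Qed.

(** For a partial isometry this matrix is an orthogonal projection, hence equal to its product with
    its own adjoint. *)
Lemma psd_compl_gram (C : numClosedFieldType) (m n : nat) (T : 'M[C]_(m, n)) :
  T *m T^t* *m T = T -> psdmx (1%:M - T *m T^t*).
Proof.
move=> TTT; rewrite [X in psdmx X](_ : _ =
    (1%:M - T *m T^t*) *m (1%:M - T *m T^t*)^t*); first exact: psd_gram.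
rewrite linearB map_mxB adjmx1 adjmxM trmxCK mulmxBr mulmx1 mulmxBl mul1mx.
by rewrite mulmxA TTT subrr subr0.
Qed.

(** * Transport of a channel between Naimark extensions *)

Lemma pic_of_extension_sub (C : numClosedFieldType) (n d m1 m2 : nat)
    (E : 'I_n -> 'M[C]_d) (P1 : 'I_n -> 'M[C]_(d + m1))
    (P2 : 'I_n -> 'M[C]_(d + m2)) (L : superop C d) :
  povm E -> naimark_extension E P1 -> naimark_extension E P2 ->
  pic_of_extension P1 L -> pic_of_extension P2 L.
Proof.
move=> Epovm EP1 EP2 /(pic_of_extensionP L EP1.1)[L1 [[L1cp L1tp] L1inc L1sub]].
apply/(pic_of_extensionP L EP2.1).
have [T [TP TV TV' TTT]] := naimark_partial_isometry Epovm EP1 EP2.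
have PT i : T^t* *m P2 i = P1 i *m T^t*.
  rewrite -(projective_measurement_adj i EP2.1) -adjmxM -TP adjmxM.
  by rewrite (projective_measurement_adj i EP1.1).
(* [M] projects onto the complement of the range of [T], and [N] onto the kernel of [T]. *)
pose M := 1%:M - T *m T^t*; pose N := 1%:M - T^t* *m T.
have Mpsd : psdmx M by exact: psd_compl_gram.
have Npsd : psdmx N.
  rewrite /N -{2}[T]trmxCK; apply: psd_compl_gram.
  by rewrite trmxCK -[in RHS]TTT !adjmxM trmxCK mulmxA.
have [d0|d_gt0] := posnP (d + m2)%N.
  (* On the zero space there is no state sigma, but all matrices are equal. *)
  have flat p (X Y : 'M[C]_(d + m2, p)) : X = Y.
    by apply/matrixP => i; have := ltn_ord i; rewrite {2}d0.
  have [L2 L2E] := @linear_pack C 'M[C]_(d + m2) 'M[C]_(d + m2) id (fun _ _ _ => erefl).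
  exists L2; split=> [|X|X]; [|exact: flat|exact: flat].
  split=> [|X]; last by rewrite L2E.
  by apply: eq_completely_positive (@completely_positive_id C _) => X; rewrite L2E.
pose sigma : 'M[C]_(d + m2) := ((d + m2)%:R)^-1 *: 1%:M.
have sigma_tr : \tr sigma = 1.
  by rewrite linearZ /= mxtrace1 mulVf // pnatr_eq0 -lt0n.
have sigma_psd : psdmx sigma.
  move=> v; rewrite -scalemxAr -scalemxAl mxE mulr_ge0 ?invr_ge0 ?ler0n //.
  by rewrite mulmx1 gram_diag sumr_ge0 // => i _; rewrite exprn_ge0.
have sigma_deph : dephasing P2 sigma = sigma.
  rewrite /sigma -EP2.1.1.2 scaler_sumr; apply: eq_bigr => i _.
  rewrite -scaler_sumr EP2.1.1.2 -scalemxAr mulmx1 -scalemxAl.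
  by rewrite EP2.1.2 eqxx.
(* Trace is lost twice: by compressing the input, which is measured by [M], and by carrying the
   output of [L1] over, which is measured by [N]. *)
pose f X := T *m L1 (T^t* *m X *m T) *m T^t* +
  (\tr (M *m X) + \tr (N *m L1 (T^t* *m X *m T))) *: sigma.
have [L2 L2E] : exists L2 : superop C (d + m2), L2 =1 f.
  apply: linear_pack => a X Y; rewrite /f.
  have -> : T^t* *m (a *: X + Y) *m T = a *: (T^t* *m X *m T) + T^t* *m Y *m T.
    by rewrite mulmxDr mulmxDl -scalemxAr -scalemxAl.
  rewrite linearP !mulmxDr mulmxDl -!scalemxAr -scalemxAl !mxtraceD !mxtraceZ.
  by rewrite (addrACA (a * _)) -mulrDr scalerDl -scalerA addrACA -scalerDr.
exists L2; split.
- split=> [|X].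
    apply: (@eq_completely_positive _ _ (fun X => T *m L1 (T^t* *m X *m T^t*^t*) *m T^t* +
      (\tr (M *m (1%:M *m X *m 1%:M^t*)) *: sigma +
       \tr (N *m L1 (T^t* *m X *m T^t*^t*)) *: sigma))).
      by move=> X; rewrite L2E /f trmxCK adjmx1 mulmx1 mul1mx scalerDl.
    apply: completely_positiveD; first exact: completely_positive_conj.
    apply: completely_positiveD; last exact: completely_positive_replace.
    apply: (completely_positive_replace (L := fun X => X)) => //.
    exact: completely_positive_id.
  rewrite L2E /f mxtraceD mxtraceZ sigma_tr mulr1; set Z := L1 _.
  (* The trace of [T *m Z *m T^t*] is that of [Z] minus that of [N *m Z], while the trace of [Z] is
     that of [X] minus that of [M *m X]; the [sigma] term restores both. *)
  have trZ : \tr Z = \tr (T *m T^t* *m X).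
    by rewrite L1tp mxtrace_mulC mulmxA.
  rewrite mxtrace_mulC mulmxA !mulmxBl !mul1mx !linearB /= trZ.
  by rewrite subrKA addrC subrK.
- move=> X; rewrite L2E /f; set Y := dephasing P2 X.
  have -> : T^t* *m Y *m T = dephasing P1 (T^t* *m X *m T).
    rewrite /Y /dephasing mulmx_sumr mulmx_suml; apply: eq_bigr => i _.
    by rewrite !mulmxA PT -!mulmxA TP.
  set Z := L1 _; have ZE : dephasing P1 Z = Z by exact: L1inc.
  have TZ : T *m Z *m T^t* = dephasing P2 (T *m Z *m T^t*).
    rewrite -{1}ZE /dephasing mulmx_sumr mulmx_suml; apply: eq_bigr => i _.
    by rewrite !mulmxA TP -!mulmxA PT.
  (* The added multiple of [sigma] is itself fixed by the dephasing. *)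
  by rewrite addrC dephasing_linear sigma_deph -TZ.
- move=> X; rewrite L2E /f.
  have -> : T^t* *m embed m2 X *m T = embed m1 X.
    by rewrite !embedE !mulmxA TV' -mulmxA -[T]trmxCK -adjmxM TV'.
  rewrite L1sub.
  (* No trace is lost on embedded operators, since [T] and its adjoint exchange the two
     inclusions. *)
  have -> : M *m embed m2 X = 0.
    by rewrite embedE !mulmxA [M *m _]mulmxBl mul1mx -(mulmxA T) TV' TV subrr !mul0mx.
  have -> : N *m embed m1 (L X) = 0.
    by rewrite embedE !mulmxA [N *m _]mulmxBl mul1mx -(mulmxA (T^t*)) TV TV' subrr !mul0mx.
  rewrite !linear0 addr0 scale0r addr0 !embedE.
  by rewrite !mulmxA TV -mulmxA -adjmxM TV.
Qed.

(** * The semidefinite feasibility problem *)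

Lemma linear_delta_eq (K : nzRingType) (m n : nat) (V : lmodType K)
    (f g : 'M[K]_(m, n) -> V) :
  linear f -> linear g -> (forall i j, f (delta_mx i j) = g (delta_mx i j)) ->
  f =1 g.
Proof.
move=> /linear_pack[f' f'E] /linear_pack[g' g'E] fg X.
rewrite -f'E -g'E (matrix_sum_delta X) !linear_sum; apply: eq_bigr => i _.
by rewrite !linear_sum; apply: eq_bigr => j _; rewrite !linearZ /= f'E g'E fg.
Qed.

Lemma trace_form (C : numClosedFieldType) (n : nat) (f : 'M[C]_n -> C^o) :
  linear f -> exists A : 'M[C]_n, forall X, \tr (A *m X) = f X.
Proof.
move=> flin; exists (\matrix_(i, j) f (delta_mx j i)).
apply: (@linear_delta_eq C n n C^o _ _ _ flin) => [a X Y|i j].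
  by rewrite mulmxDr -scalemxAr linearD linearZ.
rewrite -{1}(mul_delta_mx (0 : 'I_1)) mulmxA mxtrace_mulC -rowE -colE.
by rewrite /mxtrace big_ord1 !mxE.
Qed.

(** Constraints may be given as linear functionals indexed by any finite type: each functional is a
    trace form, and [enum_val] numbers them. *)
Lemma sdp_characterizable_linear (C : numClosedFieldType) (d N : nat) (I : finType)
    (f : I -> 'M[C]_N -> C^o) (g : I -> 'M[C]_(\sum_(i < d) d) -> C^o) (c : I -> C)
    (S : set (superop C d)) :
  (forall i, linear (f i)) -> (forall i, linear (g i)) ->
  (forall L, S L <->
     exists X, psdmx X /\ forall i, f i X = g i (choi L) + c i) ->
  sdp_characterizable S.
Proof.
move=> flin glin SE.
have /fin_all_exists[A AE] i := trace_form (flin i).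
have /fin_all_exists[B BE] i := trace_form (glin i).
exists N, #|I|, (A \o enum_val), (B \o enum_val), (c \o enum_val).
apply/seteqP; split=> L; rewrite /= SE => -[X [Xpsd XE]]; exists X; split => // i.
  by rewrite AE BE.
by have := XE (enum_rank i); rewrite /= enum_rankK AE BE.
Qed.

Lemma channel_of_choi (C : numClosedFieldType) (d : nat)
    (J : 'M[C]_(\sum_(i < d) d)) :
  psdmx J -> (forall i j, \tr (of_choi J (delta_mx i j)) = \tr (delta_mx i j : 'M[C]_d)) ->
  exists L : superop C d, L =1 of_choi J /\ channel L.
Proof.
move=> Jpsd Jtr; have [L LE] := linear_pack (of_choi_linear J).
exists L; split=> //; split.
  exact: eq_completely_positive (fsym LE) (of_choi_completely_positive Jpsd).
apply: (@linear_delta_eq C d d C^o (fun X => \tr (L X)) (fun X => \tr X)).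
- by move=> a X Y; rewrite !linearP.
- by move=> a X Y; rewrite linearP.
- by move=> i j; rewrite LE Jtr.
Qed.

Lemma pic_of_extension_sdp (C : numClosedFieldType) (n d m : nat)
    (P : 'I_n -> 'M[C]_(d + m)) :
  projective_measurement P -> sdp_characterizable (pic_of_extension P).
Proof.
move=> Pm; pose D := (d + m)%N.
(* The unknown [J] is the Choi matrix of the channel on the large space. The three summands index,
   entry by entry, trace preservation, invariance of dephased outputs, and agreement with [L] on
   embedded operators. *)
pose I : finType := ('I_D * 'I_D + 'I_D * 'I_D * ('I_D * 'I_D) +
  'I_d * 'I_d * ('I_D * 'I_D))%type.
pose f (t : I) (J : 'M[C]_(\sum_(i < D) D)) : C^o := match t with
  | inl (inl ij) => \tr (of_choi J (delta_mx ij.1 ij.2))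
  | inl (inr (ij, kl)) =>
      let X := dephasing P (delta_mx ij.1 ij.2) in
      (dephasing P (of_choi J X) - of_choi J X) kl.1 kl.2
  | inr (ij, kl) => of_choi J (embed m (delta_mx ij.1 ij.2)) kl.1 kl.2
  end.
(* Only the third group involves the given map [L]; the trace condition contributes the constants
   [c]. *)
pose g (t : I) (J : 'M[C]_(\sum_(i < d) d)) : C^o := match t with
  | inr (ij, kl) => embed m (of_choi J (delta_mx ij.1 ij.2)) kl.1 kl.2
  | inl _ => 0
  end.
pose c (t : I) : C := if t is inl (inl ij) then \tr (delta_mx ij.1 ij.2 : 'M[C]_D) else 0.
apply: (@sdp_characterizable_linear C d _ I f g c).
- move=> [[[i j]|[[i j] [k l]]]|[[i j] [k l]]] a J J' /=.
  + by rewrite of_choi_linearl linearP.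
  + rewrite of_choi_linearl dephasing_linear opprD addrACA -scalerBr.
    by rewrite [LHS]mxE [X in X + _]mxE.
  + by rewrite of_choi_linearl [LHS]mxE [X in X + _]mxE.
- move=> [t|[[i j] [k l]]] a J J' /=; first by rewrite scaler0 addr0.
  by rewrite of_choi_linearl embed_linear [LHS]mxE [X in X + _]mxE.
move=> L; rewrite (pic_of_extensionP L Pm); split.
  move=> [L' [[L'cp L'tp] L'inc L'sub]]; exists (choi L').
  split; first exact: choi_psd.
  move=> [[[i j]|[[i j] [k l]]]|[[i j] [k l]]] /=; rewrite !of_choiK.
  + by rewrite L'tp add0r.
  + by rewrite L'inc subrr mxE addr0.
  + by rewrite L'sub addr0.
move=> [J [Jpsd JE]].
have [i j|L' [L'E L'ch]] := channel_of_choi Jpsd.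
  by have := JE (inl (inl (i, j))); rewrite /= add0r.
exists L'; split => //.
- apply: linear_delta_eq => [a X Y|a X Y|i j].
  + by rewrite dephasing_linear linearP dephasing_linear.
  + by rewrite dephasing_linear linearP.
  + apply: subr0_eq; apply/matrixP => k l; rewrite [RHS]mxE !L'E.
    by have := JE (inl (inr (i, j, (k, l)))); rewrite /= addr0.
- apply: linear_delta_eq => [a X Y|a X Y|i j].
  + by rewrite embed_linear linearP.
  + by rewrite linearP embed_linear.
  + apply/matrixP => k l; rewrite L'E.
    by have := JE (inr (i, j, (k, l))); rewrite /= addr0 of_choiK.
Qed.

(** * Independence of the extension, and its consequences for [pic] *)

Lemma pic_of_extension_indep (C : numClosedFieldType) (n d m1 m2 : nat)
    (E : 'I_n -> 'M[C]_d) (P1 : 'I_n -> 'M[C]_(d + m1))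
    (P2 : 'I_n -> 'M[C]_(d + m2)) :
  povm E -> naimark_extension E P1 -> naimark_extension E P2 ->
  pic_of_extension P1 = pic_of_extension P2.
Proof.
move=> Epovm EP1 EP2; apply/seteqP.
by split=> L; [apply: (pic_of_extension_sub Epovm EP1 EP2) |
               apply: (pic_of_extension_sub Epovm EP2 EP1)].
Qed.

Lemma pic_eq_pic_of_extension (C : numClosedFieldType) (n d m : nat)
    (E : 'I_n -> 'M[C]_d) (P : 'I_n -> 'M[C]_(d + m)) :
  povm E -> naimark_extension E P -> pic E = pic_of_extension P.
Proof.
move=> Epovm EP; apply/seteqP; split=> [L [m' [P' [EP' PL]]]|L PL].
  exact: (pic_of_extension_sub Epovm EP' EP).
by exists m, P.
Qed.

Lemma pic_sdp (C : numClosedFieldType) (n d : nat) (E : 'I_n -> 'M[C]_d) :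
  povm E -> sdp_characterizable (pic E).
Proof.
move=> Epovm.
have [[m [P EP]]|noP] := pselect (exists (m : nat) (P : 'I_n -> 'M[C]_(d + m)),
    naimark_extension E P).
  rewrite (pic_eq_pic_of_extension Epovm EP).
  exact/pic_of_extension_sdp/EP.1.
(* This case never occurs, by Naimark's theorem, but it is harmless: pic E would
   be empty, hence described by the infeasible constraint 0 = 1. *)
apply: (@sdp_characterizable_linear C d 0 unit (fun _ _ => 0) (fun _ _ => 0)
  (fun _ => 1)) => [_ a X Y|_ a X Y|L]; try by rewrite scaler0 addr0.
split=> [[m [P [EP _]]]|[X [_ /(_ tt) /eqP]]]; first by case: noP; exists m, P.
by rewrite add0r eq_sym oner_eq0.
Qed.

(** * Von Neumann measurements and MIO *)

(** The added blocks are empty. Since [d + 0] does not reduce to [d], a projective measurement is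
    its own extension only through the bijection [embed 0]. *)
Lemma unembedK (C : numClosedFieldType) (d : nat) (X : 'M[C]_(d + 0)) :
  embed 0 (unembed X) = X.
Proof.
rewrite -[RHS]submxK /embed /unembed; congr block_mx; apply/matrixP.
- by move=> i [].
- by move=> [].
- by move=> [].
Qed.

Lemma embed0_naimark (C : numClosedFieldType) (n d : nat) (E : 'I_n -> 'M[C]_d) :
  projective_measurement E -> naimark_extension E (fun i => embed 0 (E i)).
Proof.
move=> [[Epsd E1] EE]; split; last first.
  move=> i rho _; rewrite /embed mulmx_block !mulmx0 !mul0mx !addr0.
  by rewrite mxtrace_block mxtrace0 addr0.
split; first split.
- by move=> i; rewrite embedE; apply: psd_conj.
- have [h hE] := linear_pack (@embed_linear C d 0).
  under eq_bigr do rewrite -hE; rewrite -linear_sum E1 hE.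
  by rewrite -[RHS]unembedK unembedE mulmx1 inclusion_isometry.
- move=> i j; rewrite /embed mulmx_block !mulmx0 !mul0mx !addr0 EE.
  by case: eqP => // _; rewrite -[RHS]unembedK unembedE mulmx0 mul0mx.
Qed.

Lemma dephasing_embed0 (C : numClosedFieldType) (n d : nat) (E : 'I_n -> 'M[C]_d)
    (X : 'M[C]_d) :
  dephasing (fun i => embed 0 (E i)) (embed 0 X) = embed 0 (dephasing E X).
Proof.
have [h hE] := linear_pack (@embed_linear C d 0).
rewrite -[RHS]hE linear_sum; apply: eq_bigr => i _.
by rewrite hE /embed !mulmx_block !(mulmx0, mul0mx, addr0).
Qed.

Lemma rank1_projective (C : numClosedFieldType) (n d : nat)
    (E : 'I_n -> 'M[C]_d) (e : 'I_n -> 'cV[C]_d) :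
  povm E -> orthonormal_basis e -> (forall i, E i = e i *m (e i)^t*) ->
  projective_measurement E.
Proof.
move=> Epovm [ee _] Ee; split=> // i j; rewrite !Ee mulmxA -(mulmxA (e i)) ee.
have [->|_] := eqVneq i j; first by rewrite mulmx1.
by rewrite mul_mx_scalar scale0r mul0mx.
Qed.

(** Completeness expands [X] into the terms [E i *m X *m E j]; those with distinct indices contain
    the off-diagonal coefficient of [X], and the others form the dephasing. *)
Lemma diagonal_inP (C : numClosedFieldType) (n d : nat)
    (E : 'I_n -> 'M[C]_d) (e : 'I_n -> 'cV[C]_d) (X : 'M[C]_d) :
  povm E -> orthonormal_basis e -> (forall i, E i = e i *m (e i)^t*) ->
  diagonal_in e X <-> dephasing E X = X.
Proof.
move=> [_ E1] [ee _] Ee; split=> [Xdiag|<- i j ij].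
  rewrite -[RHS]mulmx1 -[X in RHS]mul1mx -E1 !mulmx_suml.
  apply: eq_bigr => i _; rewrite mulmx_sumr (bigD1 i) //= big1 ?addr0 // => j ji.
  rewrite !Ee !mulmxA -!(mulmxA (e i)) Xdiag; last by rewrite eq_sym.
  by rewrite mul0mx mulmx0.
rewrite /dephasing mulmx_sumr mulmx_suml big1 // => k _.
rewrite !Ee !mulmxA ee; have [ik|_] := eqVneq i k; last by rewrite mul_scalar_mx scale0r !mul0mx.
by rewrite -!mulmxA ee -ik (negPf ij) mul_mx_scalar scale0r !mulmx0.
Qed.

Lemma pic_mio (C : numClosedFieldType) (n d : nat)
    (E : 'I_n -> 'M[C]_d) (e : 'I_n -> 'cV[C]_d) :
  povm E -> orthonormal_basis e -> (forall i, E i = e i *m (e i)^t*) ->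
  pic E = mio e.
Proof.
move=> Epovm eON Ee; have Eproj := rank1_projective Epovm eON Ee.
have EP := embed0_naimark Eproj.
rewrite (pic_eq_pic_of_extension Epovm EP).
have diagE X := diagonal_inP X Epovm eON Ee.
apply/seteqP; split=> L.
  move=> /(pic_of_extensionP L EP.1)[L' [[L'cp L'tp] L'inc L'sub]].
  have Lch : channel L.
    split=> [|X]; last by rewrite -(mxtrace_embed 0) -L'sub L'tp mxtrace_embed.
    (* [L] is [L'] conjugated by the inclusion on both sides, and so inherits complete
       positivity. *)
    have := completely_positive_conj (inclusion 0) ((inclusion 0)^t*) L'cp.
    apply: eq_completely_positive => X; rewrite -embedE L'sub trmxCK -unembedE.
    by rewrite embedK.
  split=> // rho st /diagE rhoE; split; first exact: channel_states.
  apply/diagE; have := L'inc (embed 0 rho).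
  rewrite !dephasing_embed0 rhoE L'sub dephasing_embed0.
  by move=> /(congr1 (@unembed C d 0)); rewrite !embedK.
move=> [[Lcp Ltp] Ldiag]; apply/(pic_of_extensionP L EP.1).
have [L' L'E] : exists L' : superop C (d + 0), L' =1 (fun X => embed 0 (L (unembed X))).
  apply: linear_pack => a X Y; rewrite !unembedE mulmxDr mulmxDl -scalemxAr.
  by rewrite -scalemxAl linearP embed_linear.
exists L'; split.
- split=> [|X]; last by rewrite L'E mxtrace_embed Ltp -(mxtrace_embed 0) unembedK.
  have := completely_positive_conj ((inclusion 0)^t*) (inclusion 0) Lcp.
  by apply: eq_completely_positive => X; rewrite L'E embedE trmxCK unembedE.
- move=> X; rewrite -[X]unembedK dephasing_embed0 !L'E embedK dephasing_embed0.
  congr embed; move: (unembed X) => {}X.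
  apply: (@linear_states_eq C d _ (fun X => dephasing E (L (dephasing E X)))
    (fun X => L (dephasing E X))) => [a Y Z|a Y Z|rho st].
  + by rewrite dephasing_linear linearP dephasing_linear.
  + by rewrite dephasing_linear linearP.
  (* A dephased state is diagonal by idempotence, so the hypothesis on [L] applies to it. *)
  + have [||_ /diagE //] := Ldiag (dephasing E rho).
      exact: dephasing_states.
    by apply/diagE; apply: dephasing_idem.
- by move=> X; rewrite L'E embedK.
Qed.

Theorem theorem1 (R : realType) (n d : nat) (E : 'I_n -> 'M[R[i]]_d)
    (hE : povm E) :
  [/\ forall (m1 m2 : nat) (P1 : 'I_n -> 'M[R[i]]_(d + m1))
             (P2 : 'I_n -> 'M[R[i]]_(d + m2)),
        naimark_extension E P1 -> naimark_extension E P2 ->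
        pic_of_extension P1 = pic_of_extension P2,
      sdp_characterizable (pic E) &
      forall e : 'I_n -> 'cV[R[i]]_d,
        orthonormal_basis e -> (forall i, E i = e i *m (e i)^t*) ->
        pic E = mio e].
Proof.
split; last by move=> e; apply: pic_mio.
  by move=> m1 m2 P1 P2; apply: pic_of_extension_indep.
exact: pic_sdp.
Qed.
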